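(* Let $A=I_n$ and $B,C\in\mathbb{S}^n$, and let $d$ be a positive integer. If $d<\operatorname{rank}([B,C])/2$, then the set $$\left\{\begin{pmatrix}A&\\&0_d\end{pmatrix},\ \begin{pmatrix}B&\\&0_d\end{pmatrix},\ \begin{pmatrix}C&\\&0_d\end{pmatrix}\right\}\subseteq\mathbb{S}^{n+d}$$ is not ASDC.
   Context: $\mathbb{S}^n$ denotes the real vector space of $n\times n$ real symmetric matrices, $I_n$ the $n\times n$ identity, $0_d$ the $d\times d$ zero matrix, and $[B,C]=BC-CB$. Blank blocks are zero. A set $\mathcal{A}\subseteq\mathbb{S}^N$ is simultaneously diagonalizable via congruence (SDC) if there exists an invertible $P\in\mathbb{R}^{N\times N}$ such that $P^\top A P$ is diagonal for all $A\in\mathcal{A}$. A set $\mathcal{A}\subseteq\mathbb{S}^N$ is almost simultaneously diagonalizable via congruence (ASDC) if there exist sequences $A_i\to A$ in $\mathbb{S}^N$, one for every $A\in\mathcal{A}$, such that for every $i\in\mathbb{N}$ the set $\{A_i : A\in\mathcal{A}\}$ is SDC. *)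

(* Defs.v *)
From mathcomp Require Import all_boot all_order all_algebra.
From mathcomp Require Import all_classical all_reals all_analysis.

Set Implicit Arguments.
Unset Strict Implicit.
Unset Printing Implicit Defensive.

Import Order.TTheory GRing.Theory Num.Theory.
Import numFieldNormedType.Exports.

Local Open Scope classical_set_scope.
Local Open Scope ring_scope.

Definition lie_bracket (R : realType) (n : nat) (B C : 'M[R]_n) : 'M[R]_n :=
  B *m C - C *m B.

(* [SDC] and [ASDC] are meant for sets of symmetric matrices; they are stated
   on all sets of square matrices, the symmetry of the members being a separate
   hypothesis where they are used. *)
Definition SDC (R : realType) (N : nat) (S : set 'M[R]_N) : Prop :=
  exists2 P : 'M[R]_N, P \in unitmx &
    forall A, S A -> is_diag_mx (P^T *m A *m P).

(* [u A] is the sequence attached to the member [A] of [S]; the values of [u]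
   outside [S] are irrelevant. *)
Definition ASDC (R : realType) (N : nat) (S : set 'M[R]_N) : Prop :=
  exists u : 'M[R]_N -> nat -> 'M[R]_N,
    (forall A, S A ->
       (forall i, u A i \is symmetricmx) /\ u A i @[i --> \oo] --> A) /\
    (forall i, SDC [set u A i | A in S]).

Definition pad0 (R : realType) (n d : nat) (A : 'M[R]_n) : 'M[R]_(n + d) :=
  block_mx A 0 0 (0 : 'M[R]_d).

(* Main.v *)
Require Import Defs.
From mathcomp Require Import all_boot all_order all_algebra.
From mathcomp Require Import all_classical all_reals all_analysis.

(** The obstruction is a rank inequality that survives limits: an almost
SDC triple (diag(I, 0), diag(B, 0), diag(C, 0)) with a zero block of size d
forces rank [B, C] <= 2d ([rank_comm_ASDC]).

Suppose first that [A], [B], [C] of size N are diagonalized by one congruence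
and that [A] is invertible. Then B A^-1 C = C A^-1 B, because both sides are
congruent to products of diagonal matrices ([congr_diag_comm]). Let [X] be the
inclusion of the first n coordinates, and let E be the inverse of the upper left
block of [A], padded with zeros. The columns of A X are killed by E - A^-1, so
this difference has rank at most N - n = d ([rank_compression_defect]).
Replacing A^-1 by E in the identity above therefore costs a matrix of rank at
most 2d, and the upper left block of B E C - C E B is the commutator of the
compressed matrices, twisted by the inverse of the compressed [A]
([rank_compressed_comm]).

When [A] is singular, filling the zeros of its diagonal form with a small t
makes it invertible and keeps the triple simultaneously diagonal
([congr_diag_perturb]); as t tends to 0 the twisted commutator converges. Since
a rank bound passes to the limit ([rank_le_cvg]), the inequality holds for
singular [A] as well ([rank_compressed_comm_SDC]). A second passage to the
limit, along the sequences that witness almost simultaneous diagonalizability,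
yields the bound for [B, C] itself, because there the compression of the first
matrix tends to the identity. *)

Set Implicit Arguments.
Unset Strict Implicit.
Unset Printing Implicit Defensive.

Import Order.TTheory GRing.Theory Num.Theory.
Import numFieldNormedType.Exports.

Local Open Scope classical_set_scope.
Local Open Scope ring_scope.

(** * Compressed commutators *)

(** The commutator of the compressions of [B] and [C] to the column space of
[X], taken for the product S, T |-> S G T where G inverts the compression of
[A]. It equals the ordinary commutator when [A] compresses to the identity. *)
Definition compressed_comm (F : fieldType) (N n : nat) (X : 'M[F]_(N, n))
    (A B C : 'M[F]_N) : 'M[F]_n :=
  let G := invmx (X^T *m A *m X) in
  (X^T *m B *m X) *m G *m (X^T *m C *m X)
  - (X^T *m C *m X) *m G *m (X^T *m B *m X).

(** Inverting [A] commutes with compressing it up to rank [N - n]: both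
X (X^T A X)^-1 X^T and A^-1 send A X to X, so their difference kills the
n-dimensional column space of A X. *)
Lemma rank_compression_defect (F : fieldType) (N n : nat) (X : 'M[F]_(N, n))
    (A : 'M[F]_N) : A \in unitmx -> X^T *m A *m X \in unitmx ->
  (\rank (X *m invmx (X^T *m A *m X) *m X^T - invmx A)%R <= N - n)%N.
Proof.
move=> uA uK; set K := X^T *m A *m X in uK *.
have kill : (X *m invmx K *m X^T - invmx A) *m (A *m X) = 0.
  rewrite mulmxBl mulKmx // -!mulmxA [X^T *m _]mulmxA -/K mulVmx // mulmx1.
  exact: subrr.
have le_n : (n <= \rank (A *m X))%N.
  by have := mxrankM_maxr X^T (A *m X); rewrite mulmxA mxrank_unit.
apply: leq_trans (leq_sub2l N le_n).
by rewrite -[leqLHS](addnK (\rank (A *m X))) leq_sub2r // mulmx0_rank_max.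
Qed.

(** With E = X (X^T A X)^-1 X^T and D = E - A^-1, the hypothesis turns
B E C - C E B into B D C - C D B, two terms of rank at most rank D. *)
Lemma rank_compressed_comm (F : fieldType) (N n : nat) (X : 'M[F]_(N, n))
    (A B C : 'M[F]_N) :
    A \in unitmx -> X^T *m A *m X \in unitmx ->
    B *m invmx A *m C = C *m invmx A *m B ->
  (\rank (compressed_comm X A B C) <= (N - n).*2)%N.
Proof.
move=> uA uK BC; have := rank_compression_defect uA uK.
set E := X *m _ *m X^T => leE.
have -> : compressed_comm X A B C =
    X^T *m (B *m (E - invmx A) *m C - C *m (E - invmx A) *m B) *m X.
  rewrite [B *m _]mulmxBr [C *m _]mulmxBr !mulmxBl BC opprB addrA subrK.
  by rewrite mulmxBr mulmxBl /compressed_comm /E !mulmxA.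
have leBC S T : (\rank (S *m (E - invmx A) *m T)%R <= N - n)%N.
  exact: leq_trans (mxrankM_maxl _ _) (leq_trans (mxrankM_maxr _ _) leE).
apply: leq_trans (mxrankM_maxl _ _) _.
apply: leq_trans (mxrankM_maxr _ _) _.
apply: leq_trans (mxrank_add _ _) _.
by rewrite mxrank_opp -addnn leq_add.
Qed.

(** * Limits of matrices *)

Section MatrixLimits.
Context {R : realType} {T : Type} {F : set_system T} {FF : Filter F}.

(** The topology on matrices is the product topology, which reduces limits of
matrix expressions to limits of real ones. *)
Lemma cvg_mxP (m n : nat) (M : T -> 'M[R]_(m, n)) (L : 'M[R]_(m, n)) :
  M t @[t --> F] --> L <-> forall i j, M t i j @[t --> F] --> L i j.
Proof.
split=> [ML i j U LU|ML U [P LP PsubU]].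
  apply: (ML [set N : 'M[R]_(m, n) | U (N i j)]).
  (* A neighbourhood that constrains the entry (i, j) alone. *)
  exists (fun i' j' => if (i' == i) && (j' == j) then U else setT) => [i' j'|N /=].
    by case: ifP => [/andP[/eqP-> /eqP->]//|_]; exact: filterT.
  by move/(_ i j); rewrite !eqxx.
have {}PU : \forall t \near F, forall i j, P i j (M t i j).
  apply: filter_forall => i; apply: filter_forall => j.
  exact: ML (LP i j).
by apply: filterS PU => t; exact: PsubU.
Qed.

Lemma cvg_submx (m n : nat) (M N : T -> 'M[R]_(m, n)) (L K : 'M[R]_(m, n)) :
  M t @[t --> F] --> L -> N t @[t --> F] --> K ->
  M t - N t @[t --> F] --> L - K.
Proof.
move=> /cvg_mxP ML /cvg_mxP NK; apply/cvg_mxP => i j; rewrite !mxE.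
by under eq_cvg do rewrite !mxE; exact: cvgB.
Qed.

Lemma cvg_mulmx (m n p : nat) (M : T -> 'M[R]_(m, n)) (N : T -> 'M[R]_(n, p))
    (L : 'M[R]_(m, n)) (K : 'M[R]_(n, p)) :
  M t @[t --> F] --> L -> N t @[t --> F] --> K ->
  M t *m N t @[t --> F] --> L *m K.
Proof.
move=> /cvg_mxP ML /cvg_mxP NK; apply/cvg_mxP => i j; rewrite mxE.
under eq_cvg do rewrite mxE.
by apply: cvg_big => [|k _]; [exact: add_continuous | exact: cvgM].
Qed.

Lemma cvg_det (n : nat) (M : T -> 'M[R]_n) (L : 'M[R]_n) :
  M t @[t --> F] --> L -> \det (M t) @[t --> F] --> \det L.
Proof.
move=> /cvg_mxP ML; apply: cvg_big => [|s _]; first exact: add_continuous.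
apply: cvgM; first exact: cvg_cst.
by apply: cvg_big => [|k _]; [exact: mul_continuous | exact: ML].
Qed.

Lemma near_unitmx (n : nat) (M : T -> 'M[R]_n) (L : 'M[R]_n) :
  M t @[t --> F] --> L -> L \in unitmx -> \forall t \near F, M t \in unitmx.
Proof.
move=> /cvg_det ML; rewrite unitmxE unitfE => L0.
apply: filterS (cvgr_neq0 _ ML L0) => t; by rewrite unitmxE unitfE.
Qed.

(** [invmx] is the identity on singular matrices, so Cramer's formula describes
it only near an invertible limit. *)
Lemma cvg_invmx (n : nat) (M : T -> 'M[R]_n) (L : 'M[R]_n) :
  L \in unitmx -> M t @[t --> F] --> L ->
  invmx (M t) @[t --> F] --> invmx L.
Proof.
move=> uL ML; have uM := near_unitmx ML uL.
have dL : \det L != 0 by rewrite -unitfE -unitmxE.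
have adjL : (\det (M t))^-1 *: \adj (M t) @[t --> F] -->
    (\det L)^-1 *: \adj L.
  apply/cvg_mxP => i j; rewrite !mxE; under eq_cvg do rewrite !mxE.
  apply: cvgM; first by apply: cvgV => //; exact: cvg_det.
  apply: cvgM; first exact: cvg_cst.
  apply: cvg_det; apply/cvg_mxP => k l; rewrite !mxE.
  by under eq_cvg do rewrite !mxE; move/cvg_mxP: ML; exact.
have -> : invmx L = (\det L)^-1 *: \adj L by rewrite /invmx uL.
apply: cvg_trans adjL; apply: near_eq_cvg.
by apply: filterS uM => t uMt; rewrite /invmx uMt.
Qed.

Lemma cvg_compressed_comm (N n : nat) (X : 'M[R]_(N, n))
    (A B C : T -> 'M[R]_N) (A0 B0 C0 : 'M[R]_N) :
  X^T *m A0 *m X \in unitmx ->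
  A t @[t --> F] --> A0 -> B t @[t --> F] --> B0 -> C t @[t --> F] --> C0 ->
  compressed_comm X (A t) (B t) (C t) @[t --> F]
    --> compressed_comm X A0 B0 C0.
Proof.
move=> uK AA BB CC.
have compr S S0 : S t @[t --> F] --> S0 ->
    X^T *m S t *m X @[t --> F] --> X^T *m S0 *m X.
  by move=> SS; do 2?[apply: cvg_mulmx]; (exact: SS || exact: cvg_cst).
have cA := cvg_invmx uK (compr _ _ AA).
have cB := compr _ _ BB; have cC := compr _ _ CC.
by apply: cvg_submx; apply: cvg_mulmx => //; exact: cvg_mulmx.
Qed.

End MatrixLimits.

(** Lower semicontinuity of the rank. If [L] has rank r, then U L V = 1 for some
fixed [U] and [V] with r rows and r columns respectively; near the limit U M V
stays invertible, so M has rank at least r. *)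
Lemma rank_le_cvg (R : realType) (T : Type) (F : set_system T)
    {FF : ProperFilter F} (m n k : nat) (M : T -> 'M[R]_(m, n))
    (L : 'M[R]_(m, n)) :
  M t @[t --> F] --> L -> (\forall t \near F, (\rank (M t) <= k)%N) ->
  (\rank L <= k)%N.
Proof.
move=> ML rM.
have /row_fullP[U UL] : row_full (col_base L) by exact: col_base_full.
have /row_freeP[V LV] : row_free (row_base L) by exact: row_base_free.
have ULV : U *m L *m V = 1%:M.
  by rewrite -LV -[X in _ = X *m V]mul1mx -UL -(mulmxA U (col_base L)) mulmx_base.
have UMV : U *m M t *m V @[t --> F] --> U *m L *m V.
  by apply: cvg_mulmx; [apply: cvg_mulmx => //|]; exact: cvg_cst.
have /(near_unitmx UMV) uM : U *m L *m V \in unitmx by rewrite ULV unitmx1.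
have [t [uMt rMt]] := filter_ex (filterI uM rM).
rewrite -(mxrank_unit uMt); apply: leq_trans rMt.
exact: leq_trans (mxrankM_maxl _ _) (mxrankM_maxr _ _).
Qed.

(** * Triples diagonalizable by congruence *)

(** The congruence turns A^-1 into the inverse [W] of a diagonal matrix, and [W]
commutes with all diagonal matrices because its inverse does. *)
Lemma congr_diag_comm (F : fieldType) (N : nat) (P A B C : 'M[F]_N) :
    P \in unitmx -> A \in unitmx ->
    is_diag_mx (P^T *m A *m P) -> is_diag_mx (P^T *m B *m P) ->
    is_diag_mx (P^T *m C *m P) ->
  B *m invmx A *m C = C *m invmx A *m B.
Proof.
move=> uP uA /diag_mxP[a aE] /diag_mxP[b bE] /diag_mxP[c cE].
have uPT : P^T \in unitmx by rewrite unitmx_tr.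
pose W := invmx P *m invmx A *m invmx P^T.
have aW : diag_mx a *m W = 1%:M.
  by rewrite -aE /W !mulmxA mulmxK // mulmxK // mulmxV.
have Wa : W *m diag_mx a = 1%:M by exact: mulmx1C.
have comW x : diag_mx x *m W = W *m diag_mx x.
  rewrite -[LHS]mul1mx -Wa -!mulmxA [diag_mx a *m _]mulmxA diag_mxC.
  by rewrite -mulmxA aW mulmx1.
have sandwich S T : P^T *m (S *m invmx A *m T) *m P =
    (P^T *m S *m P) *m W *m (P^T *m T *m P).
  by rewrite /W !mulmxA mulmxK // mulmxKV.
apply: (can_inj (mulKmx uPT)); apply: (can_inj (mulmxK uP)).
by rewrite !sandwich bE cE !comW -!mulmxA diag_mxC.
Qed.

(** Only the zero diagonal entries are moved, so that every nonzero [t], and not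
just a generic one, gives an invertible matrix. *)
Lemma congr_diag_perturb (F : fieldType) (N : nat) (P A : 'M[F]_N) :
    P \in unitmx -> is_diag_mx (P^T *m A *m P) ->
  exists E : 'M[F]_N, forall t, t != 0 ->
    A + t *: E \in unitmx /\ is_diag_mx (P^T *m (A + t *: E) *m P).
Proof.
move=> uP /diag_mxP[a aE]; have uPT : P^T \in unitmx by rewrite unitmx_tr.
pose e := \row_j ((a 0 j == 0)%:R : F).
exists (invmx P^T *m diag_mx e *m invmx P) => t t0.
have AtE : P^T *m (A + t *: (invmx P^T *m diag_mx e *m invmx P)) *m P =
    diag_mx (a + t *: e).
  rewrite mulmxDr mulmxDl aE -scalemxAr -scalemxAl !mulmxA mulmxV // mul1mx.
  by rewrite mulmxKV // linearD linearZ.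
split; last by rewrite AtE diag_mx_is_diag.
have : diag_mx (a + t *: e) \in unitmx.
  rewrite unitmxE det_diag unitfE; apply/prodf_neq0 => j _; rewrite !mxE.
  by have [->|a0] := eqVneq (a 0 j) 0; rewrite ?mulr1 ?add0r ?mulr0 ?addr0.
by rewrite -AtE !unitmx_mul uP uPT andbT.
Qed.

(** The invertibility of [A] assumed in [rank_compressed_comm] is removed by
letting the perturbation of [congr_diag_perturb] tend to 0. *)
Lemma rank_compressed_comm_SDC (R : realType) (N n : nat) (X : 'M[R]_(N, n))
    (P A B C : 'M[R]_N) :
    P \in unitmx -> is_diag_mx (P^T *m A *m P) ->
    is_diag_mx (P^T *m B *m P) -> is_diag_mx (P^T *m C *m P) ->
    X^T *m A *m X \in unitmx ->
  (\rank (compressed_comm X A B C) <= (N - n).*2)%N.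
Proof.
move=> uP dA dB dC uK; have [E AE] := congr_diag_perturb uP dA.
have At : A + t *: E @[t --> (0 : R)^'] --> A.
  apply/cvg_mxP => i j; under eq_cvg do rewrite !mxE.
  have : A i j + t * E i j @[t --> (0 : R)^'] --> A i j + 0 * E i j.
    apply: cvgD; first exact: cvg_cst.
    by apply: cvgMr_tmp; exact: nbhs_dnbhs.
  by rewrite mul0r addr0.
have Kt : X^T *m (A + t *: E) *m X @[t --> (0 : R)^'] --> X^T *m A *m X.
  by apply: cvg_mulmx; [apply: cvg_mulmx => //|]; exact: cvg_cst.
apply: (rank_le_cvg (cvg_compressed_comm uK At (cvg_cst B) (cvg_cst C))).
apply: filterS (filterI (near_unitmx Kt uK) (nbhs_dnbhs_neq (0 : R))) => t.
move=> [uKt t0].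
have [uAt dAt] := AE t t0.
exact: rank_compressed_comm (congr_diag_comm uP uAt dAt dB dC).
Qed.

(** Compressing to the first [n] coordinates undoes the padding, so the
compressed commutators of the approximating triples tend to [lie_bracket B C]
while their ranks stay at most [(n + d - n).*2]. *)
Lemma rank_comm_ASDC (R : realType) (n d : nat) (B C : 'M[R]_n) :
    ASDC [set pad0 d (1%:M : 'M[R]_n); pad0 d B; pad0 d C] ->
  (\rank (lie_bracket B C) <= d.*2)%N.
Proof.
set S0 := (X in ASDC X); move=> [u [u_cvg u_SDC]].
pose X : 'M[R]_(n + d, n) := col_mx 1%:M 0.
have compr S : X^T *m pad0 d S *m X = S.
  rewrite /X /pad0 tr_col_mx trmx1 trmx0 mul_row_block mul_row_col.
  by rewrite !mul1mx !mul0mx mulmx1 mulmx0 !addr0.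
have inA : S0 (pad0 d 1%:M) by left; left.
have inB : S0 (pad0 d B) by left; right.
have inC : S0 (pad0 d C) by right.
have [_ cA] := u_cvg _ inA; have [_ cB] := u_cvg _ inB.
have [_ cC] := u_cvg _ inC.
have uK : X^T *m pad0 d 1%:M *m X \in unitmx by rewrite compr unitmx1.
have Ku : X^T *m u (pad0 d 1%:M) i *m X @[i --> \oo]
    --> X^T *m pad0 d 1%:M *m X.
  by apply: cvg_mulmx; [apply: cvg_mulmx => //|]; exact: cvg_cst.
have <- : compressed_comm X (pad0 d 1%:M) (pad0 d B) (pad0 d C) =
    lie_bracket B C.
  by rewrite /compressed_comm !compr invmx1 !mulmx1.
apply: (rank_le_cvg (cvg_compressed_comm uK cA cB cC)).
apply: filterS (near_unitmx Ku uK) => i uKi.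
have [P uP dP] := u_SDC i; rewrite -[d in leqRHS](addKn n).
by apply: (rank_compressed_comm_SDC uP) => //; apply: dP;
  [exists (pad0 d 1%:M) | exists (pad0 d B) | exists (pad0 d C)].
Qed.

Theorem theorem6 (R : realType) (n d : nat) (B C : 'M[R]_n)
    (Bsym : B \is symmetricmx) (Csym : C \is symmetricmx)
    (d_gt0 : (0 < d)%N)
    (d_lt : d%:R < (\rank (lie_bracket B C))%:R / 2 :> R) :
  ~ ASDC [set pad0 d (1%:M : 'M[R]_n); pad0 d B; pad0 d C].
Proof.
move=> /rank_comm_ASDC; rewrite leqNgt => /negP; apply.
by move: d_lt; rewrite ltr_pdivlMr // -natrM ltr_nat muln2.
Qed.
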